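(* In the setting described in the context (feature regularity, the assumption on the inverse link function $f$, the constant $L\ge 1$, and $\gamma<1/L^2$), let $T$ be an integer with $T\ge\frac{64L^6}{(1-\gamma L^2)^2}$, let $w_0\in\mathcal{W}$ be a given initial point, and let $w_{t+1}=\mathcal{P}(w_t+\alpha_t g_t(w_t))$ with constant step size $\alpha_t=1/\sqrt T$ for all $t$. Let $w^*\in\mathcal{W}$ be the unique fixed point of the projected expected update, $\sigma^2=\mathbb{E}[\|g_t(w^* )\|_2^2]$, $\overline w_T=\frac1T\sum_{t=0}^{T-1}w_t$, $\overline z_T=x(s)^\top\overline w_T$ and $z^*=x(s)^\top w^*$, where $s\sim D$ is independent of the samples. Then $$\mathbb{E}\big[(z^*-\overline z_T)^2\big]\le\frac{L\left(\|w^*-w_0\|_2^2+2\sigma^2\right)}{\sqrt T\,(1-\gamma L^2)},$$ where the expectation is over $s$ and the samples.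
   Context: Setting. $\mathcal{S}$ is a finite state space (the training points), with a Markov transition kernel $P(s'\mid s)$, a stationary distribution $D(s)$ of $P$, a discount factor $\gamma\in(0,1)$, and a feature map $x:\mathcal{S}\to\mathbb{R}^d$. Each state $s$ has a label $\ell(s)\in\mathcal{Y}\subseteq\mathbb{R}$. $f:\mathbb{R}\to\mathcal{Y}$ is the inverse link function and the reward of a transition $s\to s'$ is $r=r(s,s')=f^{-1}(\ell(s))-\gamma f^{-1}(\ell(s'))$. $\mathcal{W}\subset\mathbb{R}^d$ is a nonempty convex compact set and $\mathcal{P}(w)=\arg\min_{u\in\mathcal{W}}\|w-u\|_2^2$ is the projection onto it. Assumptions. (1) Feature regularity: $\|x(s)\|_2\le 1$ for all $s\in\mathcal{S}$, and $\Sigma=\sum_s D(s)x(s)x(s)^\top$ has full rank. (2) $f$ is continuous, invertible, strictly increasing and has a derivative $f'$ that is bounded on any bounded domain. (3) $L\ge 1$ is a constant such that, for $w\in\mathcal{W}$ and all $s_1,s_2\in\mathcal{S}$, with $z_1=x(s_1)^\top w$ and $z_2=x(s_2)^\top w$, one has $\frac1L|z_1-z_2|\le|f(z_1)-f(z_2)|\le L|z_1-z_2|$. (4) Bounded discount: $\gamma<1/L^2$ for this $L$. Expected update. $\overline g(w)=\mathbb{E}\big[(f(r(s,s')+\gamma x(s')^\top w)-f(x(s)^\top w))\,x(s)\big]$, with $s\sim D$, $s'\sim P(\cdot\mid s)$. The fixed point of the projected expected update, $w^*\in\mathcal{W}$, is the unique fixed point of the map $w\mapsto\mathcal{P}(w+\alpha\,\overline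 g(w))$ on $\mathcal{W}$ with $\alpha=\frac{1-\gamma L^2}{4L^3}$. Sample-based update (i.i.d. sampling). At each step $t$ a pair $(s_t,s_t')$ is drawn, independently of the past, with $s_t\sim D$ and $s_t'\sim P(\cdot\mid s_t)$, and $g_t(w)=\big(f(r(s_t,s_t')+\gamma x(s_t')^\top w)-f(x(s_t)^\top w)\big)x(s_t)$.
   Formalization: The two-sided bound with L is assumed for predictions at any two points w1, w2 of W, not only a common w, and f is also assumed L-Lipschitz at the target arguments r(s,s')+γx(s')ᵀw, w in W; with the condition as literally stated the bound is false. *)

(* Defs.v *)
From HB Require Import structures.
From mathcomp Require Import all_boot all_order all_algebra finmap.
From mathcomp Require Import all_classical all_reals all_analysis.

Set Implicit Arguments.
Unset Strict Implicit.
Unset Printing Implicit Defensive.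

Import Order.TTheory GRing.Theory Num.Theory.
Import numFieldNormedType.Exports.

Local Open Scope classical_set_scope.
Local Open Scope ring_scope.

(* MathComp-Analysis equips matrices with the sup norm, hence the explicit
   Euclidean norm. *)
Definition dot (R : realType) (d : nat) (u v : 'cV[R]_d) : R :=
  (u^T *m v) 0 0.

Definition l2norm (R : realType) (d : nat) (u : 'cV[R]_d) : R :=
  Num.sqrt (dot u u).

(* [argmin_(u in W) ||w - u||_2^2]; when W is nonempty, convex and compact the
   minimizer exists and is unique, so [get] returns it. *)
Definition projection (R : realType) (d : nat) (W : set 'cV[R]_d) (w : 'cV[R]_d) :
    'cV[R]_d :=
  get [set p | W p /\
    forall u, W u -> l2norm (w - p) ^+ 2 <= l2norm (w - u) ^+ 2].

Definition is_distribution (R : realType) (S : finType) (D : S -> R) : Prop :=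
  (forall s, 0 <= D s) /\ \sum_s D s = 1.

(* [P s s'] is the probability P(s' | s). *)
Definition is_kernel (R : realType) (S : finType) (P : S -> S -> R) : Prop :=
  forall s, is_distribution (P s).

Definition is_stationary (R : realType) (S : finType)
    (P : S -> S -> R) (D : S -> R) : Prop :=
  is_distribution D /\ forall s', \sum_s D s * P s s' = D s'.

Definition feature_regularity (R : realType) (S : finType) (d : nat)
    (D : S -> R) (x : S -> 'cV[R]_d) : Prop :=
  (forall s, l2norm (x s) <= 1) /\
  \rank (\sum_s D s *: (x s *m (x s)^T)) = d.

Definition inverse_link (R : realType) (Y : set R) (f : R -> R) : Prop :=
  [/\ continuous f,
      set_bij [set: R] Y f,
      {homo f : a b / a < b},
      (forall z, derivable f z 1) &
      forall A : set R, bounded_set A -> [bounded derive1 f z | z in A]].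

(* [pinv setT f] is the inverse of [f] on its range Y. *)
Definition reward (R : realType) (S : finType)
    (f : R -> R) (gamma : R) (label : S -> R) (s s' : S) : R :=
  pinv setT f (label s) - gamma * pinv setT f (label s').

(* The argument of [f] in the bootstrapped target. *)
Definition target_arg (R : realType) (S : finType) (d : nat)
    (f : R -> R) (gamma : R) (label : S -> R) (x : S -> 'cV[R]_d)
    (s s' : S) (w : 'cV[R]_d) : R :=
  reward f gamma label s s' + gamma * dot (x s') w.

(* The predictions x(s)^T w are compared across weight vectors w1, w2 in W:
   required only for w1 = w2 the condition would be void for a single state,
   and would not control the distance of an iterate to the fixed point. For the
   same reason [f] is L-Lipschitz (upper bound only) at the arguments
   r(s,s') + gamma x(s')^T w of the targets, which need not be predictions. *)
Definition link_constant (R : realType) (S : finType) (d : nat)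
    (f : R -> R) (gamma : R) (label : S -> R) (x : S -> 'cV[R]_d)
    (W : set 'cV[R]_d) (L : R) : Prop :=
  [/\ 1 <= L,
      (forall w1 w2, W w1 -> W w2 -> forall s1 s2,
        let z1 := dot (x s1) w1 in
        let z2 := dot (x s2) w2 in
        L^-1 * `|z1 - z2| <= `|f z1 - f z2| <= L * `|z1 - z2|) &
      (forall w1 w2, W w1 -> W w2 -> forall s s',
        let y1 := target_arg f gamma label x s s' w1 in
        let y2 := target_arg f gamma label x s s' w2 in
        `|f y1 - f y2| <= L * `|y1 - y2|)].

Definition sample_update (R : realType) (S : finType) (d : nat)
    (f : R -> R) (gamma : R) (label : S -> R) (x : S -> 'cV[R]_d)
    (w : 'cV[R]_d) (p : S * S) : 'cV[R]_d :=
  (f (target_arg f gamma label x p.1 p.2 w) - f (dot (x p.1) w)) *: x p.1.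

Definition transition_law (R : realType) (S : finType)
    (D : S -> R) (P : S -> S -> R) (p : S * S) : R :=
  D p.1 * P p.1 p.2.

Definition expected_update (R : realType) (S : finType) (d : nat)
    (D : S -> R) (P : S -> S -> R)
    (f : R -> R) (gamma : R) (label : S -> R) (x : S -> 'cV[R]_d)
    (w : 'cV[R]_d) : 'cV[R]_d :=
  \sum_p transition_law D P p *: sample_update f gamma label x w p.

Definition update_second_moment (R : realType) (S : finType) (d : nat)
    (D : S -> R) (P : S -> S -> R)
    (f : R -> R) (gamma : R) (label : S -> R) (x : S -> 'cV[R]_d)
    (w : 'cV[R]_d) : R :=
  \sum_p transition_law D P p * l2norm (sample_update f gamma label x w p) ^+ 2.

Definition is_expected_fixpoint (R : realType) (S : finType) (d : nat)
    (D : S -> R) (P : S -> S -> R)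
    (f : R -> R) (gamma : R) (label : S -> R) (x : S -> 'cV[R]_d)
    (W : set 'cV[R]_d) (L : R) (w : 'cV[R]_d) : Prop :=
  let alpha := (1 - gamma * L ^+ 2) / (4 * L ^+ 3) in
  W w /\ projection W (w + alpha *: expected_update D P f gamma label x w) = w.

Fixpoint iterate (R : realType) (S : finType) (d : nat)
    (f : R -> R) (gamma : R) (label : S -> R) (x : S -> 'cV[R]_d)
    (W : set 'cV[R]_d) (alpha : nat -> R) (w0 : 'cV[R]_d)
    (xi : nat -> S * S) (t : nat) : 'cV[R]_d :=
  if t is t'.+1 then
    let w := iterate f gamma label x W alpha w0 xi t' in
    projection W (w + alpha t' *: sample_update f gamma label x w (xi t'))
  else w0.

Definition average_iterate (R : realType) (S : finType) (d : nat)
    (f : R -> R) (gamma : R) (label : S -> R) (x : S -> 'cV[R]_d)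
    (W : set 'cV[R]_d) (alpha : nat -> R) (w0 : 'cV[R]_d)
    (xi : nat -> S * S) (T : nat) : 'cV[R]_d :=
  T%:R^-1 *: \sum_(t < T) iterate f gamma label x W alpha w0 xi t.

Definition mutually_independent (dO : measure_display)
    (Omega : measurableType dO) (R : realType) (Pr : probability Omega R)
    (I : choiceType) (F : I -> set (set Omega)) : Prop :=
  forall (J : {fset I}) (A : I -> set Omega),
    (forall i, i \in J -> F i (A i)) ->
    Pr (\bigcap_(i in [set` J]) A i) = (\prod_(i <- J) Pr (A i))%E.

Definition has_law (dO : measure_display) (Omega : measurableType dO)
    (R : realType) (Pr : probability Omega R) (V : finType)
    (X : Omega -> V) (mu : V -> R) : Prop :=
  forall v, measurable (X @^-1` [set v]) /\ Pr (X @^-1` [set v]) = (mu v)%:E.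

(* Index [None] is the evaluation state, index [Some t] the pair drawn at
   step t. *)
Definition draw_events (Omega : Type) (S : finType)
    (st : Omega -> S) (xi : nat -> Omega -> S * S) (i : option nat) :
    set (set Omega) :=
  if i is Some t then [set xi t @^-1` B | B in [set: set (S * S)]]
  else [set st @^-1` B | B in [set: set S]].

Definition iid_sampling (dO : measure_display) (Omega : measurableType dO)
    (R : realType) (Pr : probability Omega R) (S : finType)
    (D : S -> R) (P : S -> S -> R)
    (st : Omega -> S) (xi : nat -> Omega -> S * S) : Prop :=
  [/\ has_law Pr st D,
      (forall t, has_law Pr (xi t) (transition_law D P)) &
      mutually_independent Pr (draw_events st xi)].

(* Main.v *)
Require Import Defs.
From HB Require Import structures.
From mathcomp Require Import all_boot all_order all_algebra finmap.
From mathcomp Require Import all_classical all_reals all_analysis.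
From mathcomp Require Import measurable_realfun ring lra.

Import Order.TTheory GRing.Theory Num.Theory.
Import numFieldNormedType.Exports.

Local Open Scope classical_set_scope.
Local Open Scope ring_scope.

(* The fixed point [wstar] satisfies the variational inequality
   <gbar(wstar), u - wstar> <= 0 on [W], so it is also fixed by the projected
   expected update with any other step size [beta], and nonexpansiveness gives
   ||w_{t+1} - wstar|| <= ||w_t - wstar + beta (g_t(w_t) - gbar(wstar))||.
   Let Z_t be the D-mean square of the prediction error of [w_t] relative to
   [wstar] and k = 1 - gamma L^2.  Monotonicity of the link and its two-sided
   bounds, together with stationarity, bound the mean cross term by - (k / L) Z_t
   and the mean quadratic term by 8 L^2 Z_t + 2 sigma2.  The lower bound on T makes
   8 beta^2 L^2 <= beta k / L for beta = 1 / sqrt T, whence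
     E ||w_{t+1} - wstar||^2
       <= E ||w_t - wstar||^2 - (beta k / L) E Z_t + 2 beta^2 sigma2.
   Summing over t and applying Jensen's inequality to the average finishes. *)

(** * Euclidean inner product and projection onto a compact convex set *)

Section EuclideanProjection.
Context {R : realType} {d : nat}.
Implicit Types u v w y p q : 'cV[R]_d.

Lemma dotE u v : dot u v = \sum_i u i 0 * v i 0.
Proof. by rewrite /dot mxE; apply: eq_bigr => i _; rewrite mxE. Qed.

Lemma dotC u v : dot u v = dot v u.
Proof. by rewrite !dotE; apply: eq_bigr => i _; rewrite mulrC. Qed.

Lemma dotDl u v w : dot (u + v) w = dot u w + dot v w.
Proof. by rewrite /dot linearD/= mulmxDl mxE. Qed.

Lemma dotZl a u v : dot (a *: u) v = a * dot u v.
Proof. by rewrite /dot linearZ/= -scalemxAl mxE. Qed.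

Lemma dotDr u v w : dot w (u + v) = dot w u + dot w v.
Proof. by rewrite dotC dotDl !(dotC w). Qed.

Lemma dotZr a u v : dot u (a *: v) = a * dot u v.
Proof. by rewrite dotC dotZl dotC. Qed.

Lemma dotNl u v : dot (- u) v = - dot u v.
Proof. by rewrite -scaleN1r dotZl mulN1r. Qed.

Lemma dotNr u v : dot u (- v) = - dot u v.
Proof. by rewrite dotC dotNl dotC. Qed.

Lemma dot_sumr (I : finType) (F : I -> 'cV[R]_d) u :
  dot u (\sum_i F i) = \sum_i dot u (F i).
Proof. by rewrite /dot mulmx_sumr summxE. Qed.

Definition dot_lin := (dotDl, dotDr, dotNl, dotNr, dotZl, dotZr).

Lemma dot_ge0 u : 0 <= dot u u.
Proof. by rewrite dotE sumr_ge0// => i _; rewrite -expr2 sqr_ge0. Qed.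

Lemma l2norm_sqr u : l2norm u ^+ 2 = dot u u.
Proof. by rewrite sqr_sqrtr// dot_ge0. Qed.

Lemma dot_le_half u v : 2 * dot u v <= dot u u + dot v v.
Proof. by have := dot_ge0 (u - v); rewrite !dot_lin (dotC v u); lra. Qed.

Lemma dot_sqrDZ b u v :
  dot (u + b *: v) (u + b *: v) =
  dot u u + 2 * b * dot u v + b ^+ 2 * dot v v.
Proof. by rewrite !dot_lin (dotC v u); ring. Qed.

Lemma dot_sqrD_le u v : dot (u + v) (u + v) <= 2 * dot u u + 2 * dot v v.
Proof. by have := dot_le_half u v; rewrite !dot_lin (dotC v u); lra. Qed.

Lemma continuous_dist_sqr w : continuous (fun u => dot (w - u) (w - u)).
Proof.
rewrite (_ : (fun _ => _) =
  fun u => \sum_i (w i 0 - u i 0) * (w i 0 - u i 0)); last first.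
  by apply/funext => z; rewrite dotE; apply: eq_bigr => i _; rewrite !mxE.
apply: continuous_big; first exact: add_continuous.
move=> i _ u.
have c : (w i 0 - z i 0) @[z --> u] --> w i 0 - u i 0.
  by apply: cvgB; [exact: cvg_cst | exact: coord_continuous].
exact: (cvgM c c).
Qed.

(** The extreme value theorem supplies a minimizer, so [get] in [projection] never falls back on its
    default value. *)
Lemma projectionP (W : set 'cV[R]_d) w : W !=set0 -> compact W ->
  W (projection W w) /\ forall u, W u ->
    dot (w - projection W w) (w - projection W w) <= dot (w - u) (w - u).
Proof.
move=> W0 cW.
have [c cW1 cmin] : exists2 c, c \in W &
    forall u, u \in W -> dot (w - c) (w - c) <= dot (w - u) (w - u).
  apply: compact_EVT_min => //; apply: continuous_subspaceT.
  exact: continuous_dist_sqr.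
have [] := @getPex _ [set p | W p /\
    forall u, W u -> l2norm (w - p) ^+ 2 <= l2norm (w - u) ^+ 2].
  exists c; split; first exact: set_mem.
  by move=> u Wu; rewrite !l2norm_sqr cmin// inE.
rewrite -/(projection W w) => Wp pmin; split=> // u /pmin.
by rewrite !l2norm_sqr.
Qed.

(** By convexity the minimizer [p] can be compared with [p + t *: (u - p)]; dividing by [t] leaves a
    first-order term bounded by a multiple of [t], and [t] may be taken small. *)
Lemma projection_variational (W : set 'cV[R]_d) w u :
  convex_set W -> compact W -> W u ->
  dot (w - projection W w) (u - projection W w) <= 0.
Proof.
move=> vW cW Wu.
have [Wp pmin] := projectionP W w (ex_intro _ u Wu) cW.
set p := projection W w in Wp pmin *.
have small (t : R) : 0 < t -> t <= 1 ->
    2 * dot (w - p) (u - p) <= t * dot (u - p) (u - p).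
  move=> t0 t1.
  have Wt : W (p + t *: (u - p)).
    have := vW u p (Itv01 (ltW t0) t1) (mem_set Wu) (mem_set Wp).
    move/set_mem; congr W; transitivity (t *: u + (1 - t) *: p) => //.
    by rewrite scalerBl scale1r scalerBr addrCA.
  have := pmin _ Wt; rewrite opprD addrA.
  move: (w - p) (u - p) => a b.
  rewrite !dot_lin (dotC b a) => h.
  rewrite -(ler_pM2l t0); nra.
rewrite leNgt; apply/negP => h.
have q0 := dot_ge0 (u - p).
set e := dot (w - p) _ in h small; set q := dot (u - p) _ in q0 small.
have h1 : 0 < e + q by lra.
(* If [e > 0], this [t] lies in (0, 1] even when [q = 0], and [small] would give
   [2 * (e + q) <= q]. *)
have := small (e / (e + q)); rewrite divr_gt0// => /(_ isT).
rewrite ler_pdivrMr// mul1r lerDl => /(_ q0).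
rewrite mulrAC ler_pdivlMr//; nra.
Qed.

(* Nonexpansiveness, with the fixed point condition at step size [alpha]
   transported to the step size [beta] through its variational inequality. *)
Lemma projection_fixpoint_dist (W : set 'cV[R]_d) (alpha beta : R) y g wstar :
  convex_set W -> compact W -> W wstar -> 0 < alpha -> 0 <= beta ->
  projection W (wstar + alpha *: g) = wstar ->
  dot (projection W y - wstar) (projection W y - wstar) <=
  dot (y - (wstar + beta *: g)) (y - (wstar + beta *: g)).
Proof.
move=> vW cW Ws a0 b0 fixs.
have [Wp _] := projectionP W y (ex_intro _ wstar Ws) cW.
have h1 := projection_variational W y wstar vW cW Ws.
have := projection_variational W (wstar + alpha *: g) (projection W y) vW cW Wp.
rewrite fixs addrAC subrr add0r dotZl pmulr_rle0// => h2.
set p := projection W y in h1 h2 *.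
(* The two variational inequalities bound the squared norm of [p - wstar] by its inner product with
   [y - (wstar + beta *: g)]; [h3] absorbs half of that squared norm. *)
have h3 := dot_le_half (y - (wstar + beta *: g)) (p - wstar).
have h4 : beta * dot g (p - wstar) <= 0 by exact: mulr_ge0_le0.
move: h1 h3 h4; rewrite !dot_lin ?(dotC p) ?(dotC g) ?(dotC wstar).
rewrite ?(dotC p wstar) ?(dotC p y) ?(dotC p g).
lra.
Qed.

End EuclideanProjection.

(** * Marginals of the transition law *)

Section TransitionLaw.
Context {R : realType} {S : finType} {P : S -> S -> R} {D : S -> R}.
Context (hP : is_kernel P) (hD : is_stationary P D).

Lemma transition_law_ge0 p : 0 <= transition_law D P p.
Proof. by rewrite mulr_ge0// ?hD.1.1// (hP p.1).1. Qed.

Lemma sum_transition_law_fst (h : S -> R) :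
  \sum_p transition_law D P p * h p.1 = \sum_s D s * h s.
Proof.
rewrite -(pair_bigA _ (fun s s' => D s * P s s' * h s))/=.
apply: eq_bigr => s _; rewrite -mulr_suml -mulr_sumr (hP s).2.
by rewrite mulr1.
Qed.

(** Stationarity makes the next state [D]-distributed again, so errors at the next state and at the
    current state have the same mean square. *)
Lemma sum_transition_law_snd (h : S -> R) :
  \sum_p transition_law D P p * h p.2 = \sum_s D s * h s.
Proof.
rewrite -(pair_bigA _ (fun s s' => D s * P s s' * h s'))/= exchange_big/=.
by apply: eq_bigr => s _; rewrite -mulr_suml hD.2.
Qed.

Lemma sum_transition_law : \sum_p transition_law D P p = 1.
Proof.
have := sum_transition_law_fst (fun=> 1).
by rewrite -!mulr_suml hD.1.2 !mulr1.
Qed.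

End TransitionLaw.

(** * Scalar estimates for the temporal-difference error *)

(** Here [a] is the change of the bootstrapped target, [b] that of the prediction, and [e], [e'] are
    the current and next prediction errors. The term [b] pushes towards the fixed point, while [a]
    is small through [gamma]; products of errors are split by [2 |e| |e'| <= e^2 + e'^2]. *)
Lemma td_error_bounds (R : realType) (L gamma a b e e' : R) :
  1 <= L -> 0 <= gamma <= 1 -> `|a| <= L * (gamma * `|e'|) ->
  L^-1 * e ^+ 2 <= b * e -> `|b| <= L * `|e| ->
  - 2 * ((a + b) * e) <=
    - 2 * (L^-1 * e ^+ 2) + L * gamma * (e ^+ 2 + e' ^+ 2) /\
  (a + b) ^+ 2 <= 2 * L ^+ 2 * (e ^+ 2 + e' ^+ 2).
Proof.
move=> L1 /andP[g0 g1] ha hb hb'; split.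
  have h : - (2 * (a * e)) <= 2 * (L * (gamma * `|e'|) * `|e|).
    rewrite -mulrN ler_pM2l//.
    by rewrite (le_trans (ler_norm _))// normrN normrM ler_wpM2r.
  have h2 : 2 * (`|e'| * `|e|) <= e ^+ 2 + e' ^+ 2.
    rewrite -(real_normK (num_real e)) -(real_normK (num_real e')).
    by have := sqr_ge0 (`|e'| - `|e|); lra.
  have h3 : L * gamma * (2 * (`|e'| * `|e|)) <= L * gamma * (e ^+ 2 + e' ^+ 2).
    by rewrite ler_wpM2l// mulr_ge0//; lra.
  by lra.
have h : `|a + b| <= L * (`|e| + `|e'|).
  rewrite (le_trans (ler_normD _ _))// mulrDr addrC lerD//.
  rewrite (le_trans ha)// ler_wpM2l//; first by lra.
  by rewrite ler_piMl.
rewrite -(real_normK (num_real (a + b))).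
rewrite -(real_normK (num_real e)) -(real_normK (num_real e')).
have h2 : `|a + b| ^+ 2 <= (L * (`|e| + `|e'|)) ^+ 2.
  by rewrite ler_sqr// nnegrE//; apply: le_trans h.
have h3 : 0 <= L ^+ 2 * (`|e| - `|e'|) ^+ 2 by rewrite mulr_ge0 ?sqr_ge0.
by lra.
Qed.

Lemma increasing_bilipschitz (R : realType) (f : R -> R) (c a b : R) :
  {homo f : u v / u < v} -> c * `|a - b| <= `|f a - f b| ->
  c * (b - a) ^+ 2 <= (f b - f a) * (b - a).
Proof.
move=> fi; case: (ltgtP a b) => [ab|ba|->]; last by rewrite !subrr expr0n !mulr0.
- rewrite !(distrC _ b) !(distrC _ (f b)) !gtr0_norm ?subr_gt0 ?fi// => h.
  by rewrite expr2 mulrA ler_wpM2r// subr_ge0 ltW.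
- rewrite !gtr0_norm ?subr_gt0 ?fi// => h.
  have -> : (f b - f a) * (b - a) = (f a - f b) * (a - b) by ring.
  have -> : c * (b - a) ^+ 2 = c * (a - b) * (a - b) by ring.
  by rewrite ler_wpM2r// subr_ge0 ltW.
Qed.

(** * Finite laws and the joint law of the independent draws *)

Section FiniteLaw.
Context {dO : measure_display} {Omega : measurableType dO} {R : realType}.
Context {Pr : probability Omega R}.

Lemma expectation_finite_law (V : finType) (X : Omega -> V) (law h : V -> R) :
  has_law Pr X law -> (forall v, 0 <= h v) ->
  'E_Pr[fun om => h (X om)]%E = (\sum_v law v * h v)%:E.
Proof.
move=> hX h0; have mX v : measurable (X @^-1` [set v]) by case: (hX v).
have -> : (fun om => h (X om)) =
    fun om => \sum_v h v * \1_(X @^-1` [set v]) om.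
  apply/funext => om; rewrite (bigD1 (X om))//= indicE mem_set// mulr1.
  rewrite big1 ?addr0// => v vX; rewrite indicE memNset ?mulr0//=.
  by apply/eqP; rewrite eq_sym.
rewrite unlock; under eq_integral do rewrite -sumEFin.
rewrite ge0_integral_sum//; first last.
- by move=> v om _; rewrite lee_fin mulr_ge0.
- move=> v; apply/measurable_EFinP; exact: measurable_funM.
rewrite -sumEFin; apply: eq_bigr => v _.
under eq_integral do rewrite EFinM.
rewrite ge0_integralZl_EFin//; first last.
- by apply/measurable_EFinP; exact: measurable_indic.
rewrite integral_indic// setIT EFinM muleC.
by congr (_ * _)%E; exact: (hX v).2.
Qed.

Context {S : finType} {st : Omega -> S} (xi : nat -> Omega -> S * S).
Context {P : S -> S -> R} {D : S -> R}.

(* The draws are listed most recent first, so that appending a draw is a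
   [cons]. *)
Definition draw_history om n : n.-tuple (S * S) :=
  [tuple of rev [seq xi t om | t <- iota 0 n]].

(** Fixing the evaluation state and the whole history is a finite intersection of independent
    events, indexed by [None] and by [Some t] for [t < n]. *)
Lemma draw_history_law n : iid_sampling Pr D P st xi ->
  has_law Pr (fun om => (st om, draw_history om n))
    (fun sv => D sv.1 * \prod_(p <- sv.2) transition_law D P p).
Proof.
move=> [hst hxi hind] [s v] /=.
(* Reversing [v] restores chronological order; the default [(s, s)] is not reached for indices in
   [J]. *)
pose A i := if i is Some t then xi t @^-1` [set nth (s, s) (rev v) t]
            else st @^-1` [set s].
pose js := None :: [seq Some t | t <- iota 0 n].
pose J := seq_fset tt js.
have -> : (fun om => (st om, draw_history om n)) @^-1` [set (s, v)] =
    \bigcap_(i in [set` J]) A i.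
  apply/seteqP; split=> om /=.
    move=> [es ev] i /=; rewrite seq_fsetE inE => /orP[/eqP->//|].
    case/mapP => t; rewrite mem_iota/= add0n => tn -> /=.
    by rewrite -ev /= revK (nth_map 0%N) ?size_iota// nth_iota.
  move=> h; have -> : st om = s.
    by apply: (h None); rewrite /= seq_fsetE inE eqxx.
  congr (_, _); apply: val_inj; rewrite /= -[RHS]revK; congr rev.
  apply: (@eq_from_nth _ (s, s)).
    by rewrite size_map size_iota size_rev size_tuple.
  rewrite size_map size_iota => t tn.
  rewrite (nth_map 0%N) ?size_iota// nth_iota//.
  apply: (h (Some t)); rewrite /= seq_fsetE inE/=.
  by rewrite mem_map ?mem_iota//; exact: Some_inj.
have mA i : measurable (A i).
  by case: i => [t|]; [exact: (hxi t _).1 | exact: (hst s).1].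
split; first exact: fin_bigcap_measurable.
rewrite hind; last first.
  by move=> [t|] _ /=; [exists [set nth (s, s) (rev v) t] | exists [set s]].
rewrite (perm_big js); last first.
  rewrite -[X in perm_eq _ X]undup_id ?seq_fset_perm//= map_inj_uniq.
    rewrite iota_uniq andbT; apply/mapP; by case.
  exact: Some_inj.
rewrite big_cons big_map /= (hst s).2 EFinM -[in RHS]big_rev -prodEFin.
congr (_ * _)%E.
rewrite [RHS](big_nth (s, s)) size_rev size_tuple /index_iota subn0.
by apply: eq_bigr => t _; rewrite (hxi t _).2.
Qed.

End FiniteLaw.

(** * Sums over draw histories *)

Lemma big_tuple0 (R : nmodType) (V : finType) (F : 0.-tuple V -> R) :
  \sum_v F v = F [tuple].
Proof. by rewrite (big_pred1 [tuple]) => [//|v]; rewrite (tuple0 v) /= eqxx. Qed.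

Lemma big_tupleS (R : nmodType) (V : finType) n (F : n.+1.-tuple V -> R) :
  \sum_v F v = \sum_(v : n.-tuple V) \sum_p F (cons_tuple p v).
Proof.
rewrite exchange_big pair_bigA/=.
rewrite (reindex (fun q : V * n.-tuple V => cons_tuple q.1 q.2))//=.
exists (fun v => (thead v, [tuple of behead v])) => [[p v] _|v _] /=.
  by congr (_, _); apply: val_inj.
by apply: val_inj; rewrite [in RHS](tuple_eta v).
Qed.

Lemma sum_prod_tuple (R : comNzRingType) (V : finType) (mu : V -> R) n :
  \sum_p mu p = 1 -> \sum_(v : n.-tuple V) \prod_(p <- v) mu p = 1.
Proof.
move=> mu1; elim: n => [|n IH].
  by rewrite big_tuple0 big_nil.
rewrite big_tupleS -[RHS]IH; apply: eq_bigr => v _.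
rewrite [LHS](eq_bigr (fun p => mu p * \prod_(q <- v) mu q)); last first.
  by move=> p _; rewrite /= big_cons.
by rewrite -mulr_suml mu1 mul1r.
Qed.

(** With the newest draw first, proper suffixes are the earlier histories. The full [v] is left out,
    matching an average over [w_0], ..., [w_(T-1)]. *)
Definition sum_past {T : Type} {U : nmodType} (F : seq T -> U) (v : seq T) : U :=
  \sum_(i < size v) F (drop i.+1 v).

Lemma sum_past_cons {T : Type} {U : nmodType} (F : seq T -> U) p v :
  sum_past F (p :: v) = F v + sum_past F v.
Proof. by rewrite /sum_past big_ord_recl /= drop0. Qed.

Lemma sum_past_history {T : Type} {U : nmodType} (F : seq T -> U) (xi : nat -> T) n :
  sum_past F (rev [seq xi i | i <- iota 0 n]) =
  \sum_(t < n) F (rev [seq xi i | i <- iota 0 t]).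
Proof.
elim: n => [|n IH]; first by rewrite /sum_past !big_ord0.
rewrite big_ord_recr -IH -/(mkseq xi n.+1) mkseqS rev_rcons sum_past_cons.
by rewrite addrC.
Qed.

(** * Jensen's inequality for averaged weights *)

(** This is nonnegativity of the empirical variance. *)
Lemma mean_sqr_le (R : realFieldType) n (a : 'I_n -> R) : (0 < n)%N ->
  (n%:R^-1 * \sum_i a i) ^+ 2 <= n%:R^-1 * \sum_i a i ^+ 2.
Proof.
move=> n0; have n0' : n%:R != 0 :> R by rewrite pnatr_eq0 -lt0n.
set m := n%:R^-1 * _.
have am : \sum_i a i = n%:R * m by rewrite /m mulVKf.
have : 0 <= \sum_i (a i - m) ^+ 2 by apply: sumr_ge0 => i _; exact: sqr_ge0.
rewrite (eq_bigr (fun i => a i ^+ 2 - 2 * m * a i + m ^+ 2)); last first.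
  by move=> i _; ring.
rewrite big_split sumrB/= -mulr_sumr am sumr_const card_ord -mulr_natl.
move=> h; rewrite mulrC ler_pdivlMr ?ltr0n//; lra.
Qed.

(** The quadratic form of the feature second-moment matrix at [w' - w]. *)
Definition prediction_gap {R : realType} {S : finType} {d : nat} (D : S -> R)
    (x : S -> 'cV[R]_d) (w w' : 'cV[R]_d) : R :=
  \sum_s D s * dot (x s) (w' - w) ^+ 2.

(** Predictions are linear in the weights, so Jensen applies state by state. *)
Lemma prediction_gap_mean {R : realType} {S : finType} {d : nat}
    {P : S -> S -> R} {D : S -> R} (x : S -> 'cV[R]_d) n
    (w : 'I_n -> 'cV[R]_d) (w' : 'cV[R]_d) :
  is_stationary P D -> (0 < n)%N ->
  prediction_gap D x (n%:R^-1 *: \sum_i w i) w' <=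
  n%:R^-1 * \sum_i prediction_gap D x (w i) w'.
Proof.
move=> hD n0; rewrite /prediction_gap exchange_big/= mulr_sumr.
apply: ler_sum => s _; rewrite -mulr_sumr [leRHS]mulrCA ler_wpM2l ?hD.1.1//.
apply: le_trans (mean_sqr_le _ _ _ n0); rewrite le_eqVlt; apply/orP; left.
have n0' : n%:R != 0 :> R by rewrite pnatr_eq0 -lt0n.
apply/eqP; congr (_ ^+ 2); apply: (mulfI n0'); rewrite mulVKf//.
under [RHS]eq_bigr do rewrite dotDr dotNr.
rewrite sumrB sumr_const card_ord -mulr_natl -dot_sumr.
by rewrite dotDr dotNr dotZr; field.
Qed.

(** * Drift of the projected update and its summation over time *)

Section ProjectedUpdate.
Context {R : realType} {S : finType} {d : nat}.
Context (P : S -> S -> R) (D : S -> R) (gamma : R) (x : S -> 'cV[R]_d).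
Context (label : S -> R) (f : R -> R) (W : set 'cV[R]_d) (L : R).
Context (hP : is_kernel P) (hD : is_stationary P D) (hgamma : 0 < gamma < 1).
Context (hWconvex : convex_set W) (hWcompact : compact W).
Context (hx : forall s, l2norm (x s) <= 1) (hf : {homo f : a b / a < b}).
Context (hL : link_constant f gamma label x W L).
Context (hgammaL : gamma * L ^+ 2 < 1).
Context (wstar : 'cV[R]_d).
Context (hwstar : is_expected_fixpoint D P f gamma label x W L wstar).

Local Notation mu := (transition_law D P).
Local Notation g := (sample_update f gamma label x).
Local Notation gbar := (expected_update D P f gamma label x).
Local Notation sigma2 := (update_second_moment D P f gamma label x wstar).

Let L1 : 1 <= L. Proof. by case: hL. Qed.
Let L0 : 0 < L. Proof. exact: lt_le_trans L1. Qed.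

Lemma prediction_gap_ge0 w : 0 <= prediction_gap D x w wstar.
Proof.
by apply: sumr_ge0 => s _; rewrite mulr_ge0 ?sqr_ge0// hD.1.1.
Qed.

(** The temporal-difference error at [w] minus that at [wstar], grouped into the target part and the
    prediction part that [td_error_bounds] treats separately. *)
Definition td_diff w (p : S * S) : R :=
  (f (target_arg f gamma label x p.1 p.2 w) -
   f (target_arg f gamma label x p.1 p.2 wstar)) +
  (f (dot (x p.1) wstar) - f (dot (x p.1) w)).

Lemma sample_updateB w p : g w p = g wstar p + td_diff w p *: x p.1.
Proof.
rewrite /sample_update -scalerDl; congr (_ *: _).
by rewrite /td_diff; ring.
Qed.

Lemma td_diff_bounds w p : W w ->
  let e := dot (x p.1) (wstar - w) in let e' := dot (x p.2) (wstar - w) in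
  - 2 * (td_diff w p * e) <=
    - 2 * (L^-1 * e ^+ 2) + L * gamma * (e ^+ 2 + e' ^+ 2) /\
  td_diff w p ^+ 2 <= 2 * L ^+ 2 * (e ^+ 2 + e' ^+ 2).
Proof.
move=> Ww e e'; case: hL => _ hz hy; have Ws := hwstar.1.
have he s : dot (x s) wstar - dot (x s) w = dot (x s) (wstar - w).
  by rewrite !dot_lin.
have /andP[hlo hup] := hz _ _ Ww Ws p.1 p.1.
apply: td_error_bounds => //.
- by case/andP: hgamma => ? ?; rewrite !ltW.
- apply: le_trans (hy _ _ Ww Ws p.1 p.2) _.
  (* The rewards cancel, leaving [gamma] times the prediction error at the next state. *)
  rewrite /target_arg opprD addrACA subrr add0r distrC -mulrBr he.
  by rewrite normrM gtr0_norm//; case/andP: hgamma.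
- by rewrite /e -he; apply: increasing_bilipschitz.
- by rewrite /e -he distrC [X in _ * X]distrC.
Qed.

(* The cross term with [g wstar p - gbar wstar] has mean zero, and its square
   has mean at most [sigma2], a variance being at most a second moment. *)
Lemma projected_step beta w : W w -> 0 <= beta ->
  beta <= (1 - gamma * L ^+ 2) / (8 * L ^+ 3) ->
  \sum_p mu p * l2norm (projection W (w + beta *: g w p) - wstar) ^+ 2 <=
  l2norm (w - wstar) ^+ 2 + 2 * beta ^+ 2 * sigma2 -
  beta * (1 - gamma * L ^+ 2) / L * prediction_gap D x w wstar.
Proof.
move=> Ww b0 hb.
pose e s := dot (x s) (wstar - w).
pose h p := g wstar p - gbar wstar.
pose u := w - wstar.
have mu0 := transition_law_ge0 hP hD.
have step p : l2norm (projection W (w + beta *: g w p) - wstar) ^+ 2 <=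
    dot u u + (beta * (L * gamma - 2 * L^-1) + 4 * beta ^+ 2 * L ^+ 2) *
      e p.1 ^+ 2 +
    (beta * (L * gamma) + 4 * beta ^+ 2 * L ^+ 2) * e p.2 ^+ 2 +
    2 * beta * dot u (h p) + 2 * beta ^+ 2 * dot (h p) (h p).
  rewrite l2norm_sqr.
  have alpha0 : 0 < (1 - gamma * L ^+ 2) / (4 * L ^+ 3).
    by rewrite divr_gt0 ?subr_gt0// mulr_gt0// exprn_gt0.
  have := projection_fixpoint_dist W _ beta (w + beta *: g w p) _ _
    hWconvex hWcompact hwstar.1 alpha0 b0 hwstar.2.
  move/le_trans; apply.
  have -> : w + beta *: g w p - (wstar + beta *: gbar wstar) =
      u + beta *: (td_diff w p *: x p.1 + h p).
    rewrite sample_updateB /u /h opprD addrACA; congr (_ + _).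
    rewrite -scalerBr; congr (_ *: _).
    by rewrite addrAC addrC.
  have [k1 k2] := td_diff_bounds w p Ww.
  (* Separating drift from noise costs a factor 2: hence [4 * L ^+ 2] on the errors and 2 on the
     noise. *)
  have k3 := dot_sqrD_le (td_diff w p *: x p.1) (h p).
  have hu : dot u (x p.1) = - e p.1 by rewrite /u /e dotC !dot_lin; ring.
  have x1 : dot (x p.1) (x p.1) <= 1.
    by rewrite -l2norm_sqr -[leRHS](expr1n _ 2) ler_sqr// nnegrE ?sqrtr_ge0.
  have k4 : dot (td_diff w p *: x p.1) (td_diff w p *: x p.1) <= td_diff w p ^+ 2.
    by rewrite !dot_lin mulrA -expr2 ler_piMr// sqr_ge0.
  set v := td_diff w p *: x p.1 + h p in k3 *.
  rewrite dot_sqrDZ.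
  have -> : dot u v = - (td_diff w p * e p.1) + dot u (h p).
    by rewrite /v dotDr dotZr hu; ring.
  rewrite -/(e p.1) -/(e p.2) in k1 k2.
  have k5 : beta ^+ 2 * dot v v <= beta ^+ 2 *
      (4 * L ^+ 2 * (e p.1 ^+ 2 + e p.2 ^+ 2) + 2 * dot (h p) (h p)).
    by rewrite ler_wpM2l ?sqr_ge0//; lra.
  have := ler_wpM2l b0 k1; lra.
apply: (@le_trans _ _ (\sum_p mu p * (dot u u +
    (beta * (L * gamma - 2 * L^-1) + 4 * beta ^+ 2 * L ^+ 2) * e p.1 ^+ 2 +
    (beta * (L * gamma) + 4 * beta ^+ 2 * L ^+ 2) * e p.2 ^+ 2 +
    2 * beta * dot u (h p) + 2 * beta ^+ 2 * dot (h p) (h p)))).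
  by apply: ler_sum => p _; rewrite ler_wpM2l.
have mean_g v : \sum_p mu p * dot v (g wstar p) = dot v (gbar wstar).
  by rewrite dot_sumr; apply: eq_bigr => p _; rewrite dotZr.
have mean_h : \sum_p mu p * dot u (h p) = 0.
  under eq_bigr do rewrite /h dotDr dotNr mulrBr.
  by rewrite sumrB mean_g -mulr_suml (sum_transition_law hP hD) mul1r subrr.
have mean_hh : \sum_p mu p * dot (h p) (h p) <= sigma2.
  have -> : \sum_p mu p * dot (h p) (h p) = \sum_p (mu p *
      l2norm (g wstar p) ^+ 2 - 2 * (mu p * dot (gbar wstar) (g wstar p)) +
      mu p * dot (gbar wstar) (gbar wstar)).
    apply: eq_bigr => p _; rewrite l2norm_sqr /h dotDl !dotDr !dotNl !dotNr.
    by rewrite (dotC (g wstar p) (gbar wstar)); ring.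
  rewrite big_split sumrB/= -mulr_sumr mean_g -mulr_suml.
  rewrite (sum_transition_law hP hD) -/sigma2.
  by have := dot_ge0 (gbar wstar); lra.
rewrite (eq_bigr (fun p => dot u u * mu p +
    (beta * (L * gamma - 2 * L^-1) + 4 * beta ^+ 2 * L ^+ 2) *
      (mu p * e p.1 ^+ 2) +
    (beta * (L * gamma) + 4 * beta ^+ 2 * L ^+ 2) * (mu p * e p.2 ^+ 2) +
    2 * beta * (mu p * dot u (h p)) +
    2 * beta ^+ 2 * (mu p * dot (h p) (h p)))); last by move=> p _; ring.
rewrite !big_split/= -!mulr_sumr mean_h (sum_transition_law hP hD).
rewrite (sum_transition_law_fst hP (fun s => e s ^+ 2)).
rewrite (sum_transition_law_snd hD (fun s => e s ^+ 2)) l2norm_sqr.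
rewrite -/(prediction_gap D x w wstar).
have Z0 := prediction_gap_ge0 w; set Z := prediction_gap D x w wstar in Z0 *.
have k1 := ler_wpM2l (mulr_ge0 (ler0n R 2) (sqr_ge0 beta)) mean_hh.
(* The mean drift is [- 2 * beta * (L^-1 - L * gamma) * Z]; the step size bound lets the quadratic
   term use up at most half of it. *)
have k2 : 8 * beta * L ^+ 2 <= (1 - gamma * L ^+ 2) / L.
  rewrite ler_pdivlMr//; move: hb; rewrite ler_pdivlMr; first by lra.
  by rewrite mulr_gt0// exprn_gt0.
have k3 : (1 - gamma * L ^+ 2) / L = L^-1 - L * gamma.
  by field; rewrite lt0r_neq0.
have := ler_wpM2l (mulr_ge0 b0 Z0) k2.
rewrite -[_ * _ / L]mulrA k3; lra.
Qed.

Context (w0 : 'cV[R]_d) (hw0 : W w0).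
Context (beta : R) (hbeta0 : 0 <= beta).
Context (hbeta : beta <= (1 - gamma * L ^+ 2) / (8 * L ^+ 3)).

(** Iterates as functions of a finite list of draws, newest first, so that expectations become
    finite sums. *)
Fixpoint run (v : seq (S * S)) : 'cV[R]_d :=
  if v is p :: v' then projection W (run v' + beta *: g (run v') p) else w0.

Lemma run_in v : W (run v).
Proof.
by case: v => [|p v] //=; apply: (projectionP W _ _ hWcompact).1; exists w0.
Qed.

Lemma iterate_run xi t :
  iterate f gamma label x W (fun=> beta) w0 xi t =
  run (rev [seq xi i | i <- iota 0 t]).
Proof. by elim: t => // t IH; rewrite -/(mkseq xi t.+1) mkseqS rev_rcons /= IH. Qed.

(* The sum runs over all draw histories, weighted by their probability: it is the
   expectation of a potential that grows by at most [2 beta^2 sigma2] per step. *)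
Lemma expected_potential n :
  \sum_(v : n.-tuple (S * S)) (\prod_(p <- v) mu p) *
    (l2norm (run v - wstar) ^+ 2 + beta * (1 - gamma * L ^+ 2) / L *
      sum_past (fun v' => prediction_gap D x (run v') wstar) v) <=
  l2norm (w0 - wstar) ^+ 2 + n%:R * (2 * beta ^+ 2 * sigma2).
Proof.
elim: n => [|n IH].
  by rewrite big_tuple0 /sum_past big_nil big_ord0 /= mulr0 mul0r mul1r.
set c := beta * _ / L in IH *; set Z := fun v' => prediction_gap _ _ _ _ in IH *.
(* Summing over the newest draw with [v] fixed plays the role of conditioning on the past: the
   decrease from [projected_step] cancels the new summand [c * Z v]. *)
rewrite big_tupleS; apply: (@le_trans _ _ (\sum_(v : n.-tuple (S * S))
    (\prod_(p <- v) mu p) * (l2norm (run v - wstar) ^+ 2 + c * sum_past Z v +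
      2 * beta ^+ 2 * sigma2))).
  apply: ler_sum => v _.
  rewrite [leLHS](eq_bigr (fun p => (\prod_(q <- v) mu q) * (mu p *
      l2norm (projection W (run v + beta *: g (run v) p) - wstar) ^+ 2 +
      c * (Z v + sum_past Z v) * mu p))); last first.
    by move=> p _; rewrite /= big_cons sum_past_cons; ring.
  rewrite -mulr_sumr; apply: ler_wpM2l.
    by apply: prodr_ge0 => p _; exact: transition_law_ge0.
  rewrite big_split/= -mulr_sumr (sum_transition_law hP hD) mulr1.
  have := projected_step beta _ (run_in v) hbeta0 hbeta.
  by rewrite -/c -/(Z v); lra.
under eq_bigr do rewrite mulrDr.
rewrite big_split/= -mulr_suml.
rewrite (sum_prod_tuple _ _ _ _ (sum_transition_law hP hD)) mul1r.
by rewrite -natr1; lra.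
Qed.

(** Jensen bounds the gap of the average by the mean past gap; the final squared distance in the
    potential is nonnegative and is dropped. *)
Lemma expected_average_gap (n : nat) : (0 < n)%N -> 0 < beta ->
  \sum_(v : n.-tuple (S * S)) (\prod_(p <- v) mu p) *
    prediction_gap D x (n%:R^-1 *: sum_past run v) wstar <=
  L / (n%:R * beta * (1 - gamma * L ^+ 2)) *
    (l2norm (w0 - wstar) ^+ 2 + n%:R * (2 * beta ^+ 2 * sigma2)).
Proof.
move=> n0 beta0; have n0' : 0 < n%:R :> R by rewrite ltr0n.
have k0 : 0 < 1 - gamma * L ^+ 2 by rewrite subr_gt0.
apply: le_trans (ler_wpM2l _ (expected_potential n)); last first.
  by rewrite divr_ge0 ?(ltW L0)// !mulr_ge0// ltW.
rewrite mulr_sumr; apply: ler_sum => v _; rewrite mulrCA ler_wpM2l//.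
  by apply: prodr_ge0 => p _; exact: transition_law_ge0.
rewrite {1}/sum_past size_tuple.
apply: le_trans (prediction_gap_mean _ _ _ _ hD n0) _.
rewrite mulrDr /sum_past size_tuple -[leLHS]add0r lerD//.
  by rewrite mulr_ge0 ?sqr_ge0// divr_ge0 ?(ltW L0)// !mulr_ge0// ltW.
rewrite mulrA ler_wpM2r//.
  by apply: sumr_ge0 => i _; exact: prediction_gap_ge0.
rewrite le_eqVlt; apply/orP; left; apply/eqP; field.
by rewrite !lt0r_neq0.
Qed.

End ProjectedUpdate.

(** * From finite sums to the probability space *)

Theorem theorem5p11
  (R : realType) (S : finType) (d : nat)
  (P : S -> S -> R) (D : S -> R) (gamma : R) (x : S -> 'cV[R]_d)
  (Y : set R) (label : S -> R) (f : R -> R) (W : set 'cV[R]_d) (L : R)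
  (hP : is_kernel P)
  (hD : is_stationary P D)
  (hgamma : 0 < gamma < 1)
  (hlabel : forall s, Y (label s))
  (hW0 : W !=set0)
  (hWconvex : convex_set W)
  (hWcompact : compact W)
  (hx : feature_regularity D x)
  (hf : inverse_link Y f)
  (hL : link_constant f gamma label x W L)
  (hgammaL : gamma < 1 / L ^+ 2)
  (T : nat)
  (hT : 64 * L ^+ 6 / (1 - gamma * L ^+ 2) ^+ 2 <= T%:R)
  (w0 : 'cV[R]_d) (hw0 : W w0)
  (wstar : 'cV[R]_d)
  (hwstar : unique (is_expected_fixpoint D P f gamma label x W L) wstar)
  (dO : measure_display) (Omega : measurableType dO) (Pr : probability Omega R)
  (st : Omega -> S) (xi : nat -> Omega -> S * S)
  (hsampling : iid_sampling Pr D P st xi) :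
  let alpha := fun _ : nat => 1 / Num.sqrt (T%:R : R) in
  let sigma2 := update_second_moment D P f gamma label x wstar in
  let wbar := fun om : Omega =>
    average_iterate f gamma label x W alpha w0 (fun t => xi t om) T in
  let zbar := fun om : Omega => dot (x (st om)) (wbar om) in
  let zstar := fun om : Omega => dot (x (st om)) wstar in
  ('E_Pr[fun om => ((zstar om - zbar om) ^+ 2)%R] <=
    (L * (l2norm (wstar - w0) ^+ 2 + 2 * sigma2) /
      (Num.sqrt (T%:R : R) * (1 - gamma * L ^+ 2)))%:E)%E.
Proof.
cbv zeta; have L1 : 1 <= L by case: hL.
have L0 : 0 < L by exact: lt_le_trans L1.
have gL : gamma * L ^+ 2 < 1 by rewrite -ltr_pdivlMr ?exprn_gt0.
have k0 : 0 < 1 - gamma * L ^+ 2 by rewrite subr_gt0.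
have T0' : 0 < T%:R :> R.
  by apply: lt_le_trans hT; rewrite divr_gt0 ?exprn_gt0// mulr_gt0// exprn_gt0.
have T0 : (0 < T)%N by rewrite ltr0n in T0'.
pose beta : R := 1 / Num.sqrt T%:R.
have sT0 : 0 < Num.sqrt (T%:R : R) by rewrite sqrtr_gt0.
have sT2 : Num.sqrt (T%:R : R) ^+ 2 = T%:R by rewrite sqr_sqrtr// ltW.
have beta0 : 0 < beta by rewrite divr_gt0.
have hbeta : beta <= (1 - gamma * L ^+ 2) / (8 * L ^+ 3).
  have L3 : 0 < 8 * L ^+ 3 by rewrite mulr_gt0// exprn_gt0.
  have q0 := ltW (divr_gt0 L3 k0).
  (* This is the square root of [hT]. *)
  have : 8 * L ^+ 3 / (1 - gamma * L ^+ 2) <= Num.sqrt T%:R.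
    rewrite -ler_sqr ?nnegrE ?(ltW sT0)// sT2 (le_trans _ hT)//.
    by rewrite expr_div_n exprMn -exprM -natrX.
  rewrite ler_pdivrMr// => h.
  by rewrite /beta ler_pdivrMr// mulrAC ler_pdivlMr// mul1r [leRHS]mulrC.
have fi : {homo f : a b / a < b} by case: hf.
have law := draw_history_law xi T hsampling.
pose h (sv : S * T.-tuple (S * S)) := dot (x sv.1) (wstar - T%:R^-1 *: sum_past
  (run gamma x label f W w0 beta) sv.2) ^+ 2.
have gapE om : (dot (x (st om)) wstar - dot (x (st om))
    (average_iterate f gamma label x W (fun=> 1 / Num.sqrt T%:R) w0
      (xi ^~ om) T)) ^+ 2 = h (st om, draw_history xi om T).
  rewrite /h dotDr dotNr; congr ((_ - dot _ (_ *: _)) ^+ 2).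
  by rewrite sum_past_history; apply: eq_bigr => t _; rewrite -iterate_run.
rewrite (funext gapE).
rewrite (expectation_finite_law _ _ _ _ law); last by move=> v; exact: sqr_ge0.
(* The joint law is a product, so for a fixed history the sum over the evaluation state is a
   [prediction_gap]. *)
rewrite lee_fin -(pair_bigA _ (fun s v => D s *
  \prod_(p <- tval v) transition_law D P p * h (s, v)))/= exchange_big/=.
have := expected_average_gap P D gamma x label f W L hP hD hgamma hWconvex
  hWcompact hx.1 fi hL gL wstar hwstar.1 w0 hw0 beta (ltW beta0) hbeta T T0 beta0.
(* For [beta = 1 / sqrt T] the accumulated noise over [T] steps is exactly [2 * s2], and the
   denominator becomes [sqrt T]. *)
have Tbeta : T%:R * beta = Num.sqrt T%:R.
  by rewrite -{1}sT2 /beta div1r expr2 mulfK// lt0r_neq0.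
have Tbeta2 : T%:R * beta ^+ 2 = 1.
  by rewrite expr2 mulrA Tbeta /beta div1r divff// lt0r_neq0.
set s2 := update_second_moment _ _ _ _ _ _ _.
have -> : T%:R * (2 * beta ^+ 2 * s2) = T%:R * beta ^+ 2 * (2 * s2) by ring.
rewrite Tbeta Tbeta2 mul1r.
have -> : l2norm (w0 - wstar) ^+ 2 = l2norm (wstar - w0) ^+ 2.
  by rewrite !l2norm_sqr -(opprB wstar) dotNl dotNr opprK.
rewrite [leRHS]mulrAC => /(le_trans _); apply.
apply: ler_sum => v _; rewrite mulr_sumr; apply: ler_sum => s _.
by rewrite [leRHS]mulrCA mulrA.
Qed.
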